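(* Let $d\ge 2$ be an integer and let $(G_n)$ be a sequence of finite $d$-regular graphs which is an expander sequence, with $\mathrm{girth}(G_n)\to\infty$. Let $p\in[0,1]$. (i) If $p>1/(d-1)$, then there exists $c>0$ such that $$\mathbb{P}\big(G_n(p)\text{ contains a connected component of order at least } c|V(G_n)|\big)\to 1\quad\text{as } n\to\infty.$$ (ii) If $p<1/(d-1)$, then for any $c>0$, $$\mathbb{P}\big(G_n(p)\text{ contains a connected component of order at least } c|V(G_n)|\big)\to 0\quad\text{as } n\to\infty.$$
   Context: For a graph $G$ and $p\in[0,1]$, $G(p)$ denotes the random spanning subgraph of $G$ obtained by retaining each edge of $G$ independently with probability $p$. The order of a component is its number of vertices. The girth of a graph is the minimum length of a cycle in it. For a finite graph $G=(V,E)$, the edge-isoperimetric number is $c(G)=\min\{|E(A,V\setminus A)|/|A| : A\subset V,\ 0<|A|\le|V|/2\}$, where $E(A,B)$ is the set of edges with one endpoint in $A$ and the other in $B$. A sequence $(G_n)$ of graphs with uniformly bounded degrees is an expander sequence if there is $b>0$ with $c(G_n)\ge b$ for all $n$. (For bounded degree sequences, this is equivalent to the corresponding condition with the edge boundary replaced by the external vertex boundary.) *)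

(* Defs.v *)
From HB Require Import structures.
From mathcomp Require Import all_boot all_order all_algebra.
From mathcomp Require Import all_classical all_reals all_analysis.

Set Implicit Arguments.
Unset Strict Implicit.
Unset Printing Implicit Defensive.

Import Order.TTheory GRing.Theory Num.Theory.
Import numFieldNormedType.Exports.

Local Open Scope ring_scope.

Record sgraph := SGraph {
  svertex :> finType;
  sedge : rel svertex;
  sedge_sym : symmetric sedge;
  sedge_irrefl : irreflexive sedge;
  svertex_gt0 : (0 < #|svertex|)%N }.

Definition edges (G : sgraph) : {set {set G}} :=
  [set [set u.1; u.2] | u in [pred u : G * G | sedge u.1 u.2]].

Definition degree (G : sgraph) (x : G) : nat := #|[set y | sedge x y]|.

Definition regular (d : nat) (G : sgraph) : Prop :=
  forall x : G, degree x = d.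

Definition edges_between (G : sgraph) (A B : {set G}) : {set {set G}} :=
  [set f in edges G | [exists x in A, exists y in B, f == [set x; y]]].

(* The infimum is over a finite set, hence a minimum, unless #|G| = 1, where
   it is +oo. *)
Definition edge_isoperimetric_number (R : realType) (G : sgraph) : \bar R :=
  ereal_inf
    [set r | exists A : {set G},
       [/\ (0 < #|A|)%N, (2 * #|A| <= #|G|)%N
         & r = (#|edges_between A (~: A)|%:R / #|A|%:R)%:E]]%classic.

Definition expander_sequence (R : realType) (G : nat -> sgraph) : Prop :=
  (exists D : nat, forall n (x : G n), (degree x <= D)%N) /\
  (exists b : R, 0 < b /\
     forall n, (b%:E <= edge_isoperimetric_number R (G n))%E).

(* c lists the vertices of a cycle once each, in cyclic order; the bound on
   size c excludes back-and-forth walks along a single edge, which ucycle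
   accepts. *)
Definition is_cycle (G : sgraph) (c : seq G) : Prop :=
  (3 <= size c)%N /\ ucycle (@sedge G) c.

(* Acyclic graphs have girth +oo. *)
Definition girth (R : realType) (G : sgraph) : \bar R :=
  ereal_inf
    [set r | exists c : seq G, is_cycle c /\ r = (size c)%:R%:E]%classic.

Definition spanning_edge (G : sgraph) (F : {set {set G}}) : rel G :=
  fun x y => sedge x y && ([set x; y] \in F).

Lemma spanning_edge_sym (G : sgraph) (F : {set {set G}}) :
  symmetric (spanning_edge F).
Proof. by move=> x y; rewrite /spanning_edge sedge_sym finset.setUC. Qed.

Lemma spanning_edge_irrefl (G : sgraph) (F : {set {set G}}) :
  irreflexive (spanning_edge F).
Proof. by move=> x; rewrite /spanning_edge sedge_irrefl. Qed.

Definition spanning_subgraph (G : sgraph) (F : {set {set G}}) : sgraph :=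
  SGraph (@spanning_edge_sym G F) (@spanning_edge_irrefl G F) (svertex_gt0 G).

(* The probability that G(p) satisfies Q: the set F of retained edges follows
   the product Bernoulli(p) law on the subsets of edges G. *)
Definition percolation_prob (R : realType) (p : R) (G : sgraph)
    (Q : pred sgraph) : R :=
  \sum_(F in powerset (edges G) | Q (spanning_subgraph F))
    \prod_(f in edges G) (if f \in F then p else 1 - p).

Definition components (G : sgraph) : {set {set G}} :=
  [set [set y | connect (@sedge G) x y] | x in [set: G]].

Definition has_component_ge (R : realType) (c : R) : pred sgraph :=
  fun G => [exists C in components G, c * #|G|%:R <= #|C|%:R].

(* Main.v *)
Require Import Defs.
From mathcomp Require Import all_boot all_order all_algebra.
From mathcomp Require Import reals.
From mathcomp Require Import ring lra.

(** Supercritical case (Alon, Benjamini and Stacey).  Write 1 - p = (1 - r)(1 - e)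
    with r still above 1/(d-1).  As long as 2k is less than the girth, walks of
    length k from a vertex see a tree, and the branching recursion
    1 - x_(k+1) = (1 - r x_k)^(d-1) keeps the probability of reaching distance k
    above some a > 0 independent of k; these events are local, so by Chebyshev's
    inequality about a|V|/2 vertices lie in r-clusters of order at least k.  If
    sprinkling with density e creates no cluster of order a|V|/6, then the at
    most |V|/k large r-clusters split into two groups of at least a|V|/6 vertices
    with no sprinkled path in between.  Expansion yields a number proportional to
    |V| of edge-disjoint paths of bounded length between the two groups, so each
    split has probability exponentially small in |V|, at a rate independent of k,
    and for k large this beats the 2^(|V|/k) possible splits.

    Subcritical case.  Counting self-avoiding walks, the expected order of a
    cluster is bounded, and a cluster of order c|V| makes the sum of the cluster
    orders over all vertices at least (c|V|)^2; conclude by Markov's inequality. *)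

Set Implicit Arguments.
Unset Strict Implicit.
Unset Printing Implicit Defensive.

Import Order.TTheory GRing.Theory Num.Theory.

Local Open Scope ring_scope.

(** * Product Bernoulli measure *)

Lemma set_induction (T : finType) (P : {set T} -> Prop) :
  P set0 -> (forall x (A : {set T}), x \notin A -> P A -> P (x |: A)) -> forall A, P A.
Proof.
move=> P0 PU A; have [n] := ubnP #|A|; elim: n A => // n IHn A.
have [->|[x xA]] := set_0Vmem A; first by [].
rewrite (cardsD1 x) xA ltnS => ltAn; rewrite -(setD1K xA).
by apply: PU; [rewrite !inE eqxx | apply: IHn].
Qed.

Section Expectation.
Variables (R : realType) (T : finType).
Implicit Types (p r : R) (E A B F S : {set T}) (g h : {set T} -> R).

Definition weight p E F : R := \prod_(f in E) (if f \in F then p else 1 - p).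

Definition expect p E g : R := \sum_(F in powerset E) weight p E F * g F.

(** Measurability of [g] with respect to the coordinates in [A], phrased as an invariance. *)
Definition depends_on A g := forall F, g (F :&: A) = g F.

Lemma eq_expect p E g h : g =1 h -> expect p E g = expect p E h.
Proof. by move=> gh; apply: eq_bigr => F _; rewrite gh. Qed.

Lemma expectD p E g h :
  expect p E (fun F => g F + h F) = expect p E g + expect p E h.
Proof. by rewrite -big_split; apply: eq_bigr => F _; rewrite mulrDr. Qed.

Lemma expectZ p E a g : expect p E (fun F => a * g F) = a * expect p E g.
Proof. by rewrite mulr_sumr; apply: eq_bigr => F _; rewrite mulrCA. Qed.

Lemma expect_sum p E (I : Type) (r : seq I) (P : pred I) (g : I -> {set T} -> R) :
  expect p E (fun F => \sum_(i <- r | P i) g i F) =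
  \sum_(i <- r | P i) expect p E (g i).
Proof.
by rewrite exchange_big; apply: eq_bigr => F _; rewrite mulr_sumr.
Qed.

Lemma weight_ge0 p E F : 0 <= p <= 1 -> 0 <= weight p E F.
Proof.
move=> /andP[p0 p1]; apply: prodr_ge0 => f _.
by case: ifP => // _; rewrite subr_ge0.
Qed.

Lemma le_expect p E g h : 0 <= p <= 1 ->
  (forall F, F \subset E -> g F <= h F) -> expect p E g <= expect p E h.
Proof.
move=> p01 gh; apply: ler_sum => F; rewrite powersetE => FE.
by rewrite ler_wpM2l ?weight_ge0 ?gh.
Qed.

(** Fubini: [F] corresponds to the pair of its traces on [A] and [B], and the weight factors
    accordingly. *)
Lemma expect_setU p A B g : [disjoint A & B] ->
  expect p (A :|: B) g =
  expect p A (fun F => expect p B (fun F' => g (F :|: F'))).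
Proof.
move=> dAB; rewrite /expect.
under [RHS]eq_bigr do rewrite mulr_sumr.
rewrite pair_big_dep /=.
rewrite (reindex_onto (fun F => (F :&: A, F :&: B)) (fun q => q.1 :|: q.2)) /=.
  apply: eq_big => [F | F].
    rewrite !powersetE !subsetIr /= -setIUr.
    exact: (sameP setIidPl eqP).
  rewrite powersetE => /setIidPl FE.
  rewrite -setIUr FE mulrA; congr (_ * _).
  rewrite /weight (eq_bigl [in [predU A & B]]); last first.
    by move=> f; rewrite !inE.
  rewrite bigU //=; congr (_ * _).
    by apply: eq_bigr => f fA; rewrite inE fA andbT.
  by apply: eq_bigr => f fB; rewrite inE fB andbT.
move=> [F F'] /=; rewrite !powersetE => /andP[FA FB].
rewrite !setIUl (setIidPl FA) (setIidPl FB).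
have /eqP-> : F :&: B == set0.
  by rewrite setI_eq0 (disjointWl FA).
have /eqP-> : F' :&: A == set0.
  by rewrite setI_eq0 disjoint_sym (disjointWr FB).
by rewrite setU0 set0U.
Qed.

Lemma expect_set0 p g : expect p set0 g = g set0.
Proof. by rewrite /expect powerset0 big_set1 /weight big_set0 mul1r. Qed.

Lemma expect_set1 p f g :
  expect p [set f] g = p * g [set f] + (1 - p) * g set0.
Proof.
rewrite /expect.
have -> : powerset [set f] = [set [set f]; set0].
  by apply/setP => F; rewrite !inE subset1.
rewrite big_setU1 /= ?big_set1 /weight ?big_set1 ?set11 ?inE //.
by apply/eqP => /setP/(_ f); rewrite !inE eqxx.
Qed.

Lemma expect_setU1 p f E g : f \notin E ->
  expect p (f |: E) g =
  p * expect p E (fun F => g (f |: F)) + (1 - p) * expect p E g.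
Proof.
move=> fE; rewrite expect_setU ?disjoints1 // expect_set1; congr (_ + _ * _).
by apply: eq_expect => F; rewrite set0U.
Qed.

Lemma expect_cst p E a : expect p E (fun=> a) = a.
Proof.
elim/set_induction: E => [|f E fE IH]; first exact: expect_set0.
by rewrite expect_setU1 // IH -mulrDl addrC subrK mul1r.
Qed.

(* Sprinkling: retaining with probability r, then retrying the rejected
   elements with probability e. *)
Lemma expect_sprinkle p r e E g : 1 - p = (1 - r) * (1 - e) ->
  expect p E g = expect r E (fun F => expect e E (fun F' => g (F :|: F'))).
Proof.
move=> pre; elim/set_induction: E g => [|f E fE IH] g.
  by rewrite !expect_set0 set0U.
rewrite !expect_setU1 //.
rewrite (IH (fun F => g (f |: F))) (IH g).
(* Once [f] is kept in the first round, its second trial is irrelevant, so the two outcomes of that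
   trial merge. *)
under [X in _ = r * X + _]eq_expect => F.
  rewrite expect_setU1 //.
  rewrite (@eq_expect _ _ _ (fun F' => g (f |: (F :|: F')))); last first.
    by move=> F'; rewrite setUACA setUid.
  rewrite (@eq_expect _ _ (fun F' => g (f |: F :|: F'))
    (fun F' => g (f |: (F :|: F')))); last by move=> F'; rewrite setUA.
  rewrite -mulrDl addrC subrK mul1r.
  over.
under [X in _ = _ + (1 - r) * X]eq_expect => F.
  rewrite expect_setU1 //.
  rewrite (@eq_expect _ _ _ (fun F' => g (f |: (F :|: F')))); last first.
    by move=> F'; rewrite setUCA.
  over.
rewrite expectD !expectZ; rewrite pre.
have -> : p = 1 - (1 - r) * (1 - e) by rewrite -pre; ring.
ring.
Qed.

Lemma depends_onW A B g : A \subset B -> depends_on A g -> depends_on B g.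
Proof.
by move=> sAB gA F; rewrite -gA -setIA (setIidPr sAB) gA.
Qed.

Lemma depends_onM A B g h : depends_on A g -> depends_on B h ->
  depends_on (A :|: B) (fun F => g F * h F).
Proof.
move=> gA hB F; congr (_ * _).
  exact: (depends_onW (subsetUl A B) gA).
exact: (depends_onW (subsetUr A B) hB).
Qed.

(** Split [E] along [A]: [g] sees only the part inside, [h] only the part outside, and Fubini
    factors the sum. *)
Lemma expect_indep p E A B g h : depends_on A g -> depends_on B h ->
  [disjoint A & B] ->
  expect p E (fun F => g F * h F) = expect p E g * expect p E h.
Proof.
move=> gA hB dAB.
have dE : [disjoint E :&: A & E :\: A].
  by rewrite -setI_eq0; apply/eqP/setP => x; rewrite !inE; case: (x \in A) => //=; rewrite ?andbF.
have gE F F' : F \subset E :&: A -> F' \subset E :\: A -> g (F :|: F') = g F.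
  rewrite subsetI subsetD => /andP[_ FA] /andP[_ dF].
  rewrite -gA setIUl (setIidPl FA); move: dF; rewrite -setI_eq0 => /eqP->.
  by rewrite setU0.
have hE F F' : F \subset E :&: A -> F' \subset E :\: A -> h (F :|: F') = h F'.
  rewrite subsetI => /andP[_ FA] _.
  rewrite -hB setIUl -[RHS]hB.
  have := disjointWl FA dAB; rewrite -setI_eq0 => /eqP->.
  by rewrite set0U.
rewrite -{1 2 3}(setID E A) !expect_setU //.
have -> : expect p (E :&: A) (fun F => expect p (E :\: A) (fun F' => g (F :|: F')))
   = expect p (E :&: A) g.
  apply: eq_bigr => F; rewrite powersetE => FA; congr (_ * _).
  rewrite -[RHS](expect_cst p (E :\: A)); apply: eq_bigr => F'.
  by rewrite powersetE => F'A; rewrite gE.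
have -> : expect p (E :&: A) (fun F => expect p (E :\: A) (fun F' => h (F :|: F')))
   = expect p (E :\: A) h.
  rewrite -[RHS](expect_cst p (E :&: A)).
  apply: eq_bigr => F; rewrite powersetE => FA; congr (_ * _).
  by apply: eq_bigr => F'; rewrite powersetE => F'A; rewrite hE.
rewrite /expect mulr_suml; apply: eq_bigr => F; rewrite powersetE => FA.
rewrite -mulrA; congr (_ * _); rewrite mulr_sumr; apply: eq_bigr => F'.
by rewrite powersetE => F'A; rewrite gE // hE // mulrCA.
Qed.

Lemma expect_depends p E A g : A \subset E -> depends_on A g ->
  expect p E g = expect p A g.
Proof.
move=> AE gA; rewrite -(setID E A) (setIidPr AE) expect_setU; last first.
  by rewrite -setI_eq0; apply/eqP/setP => x; rewrite !inE; case: (x \in A).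
apply: eq_bigr => F; rewrite powersetE => FA; congr (_ * _).
rewrite -[RHS](expect_cst p (E :\: A)); apply: eq_bigr => F'.
rewrite powersetE subsetD => /andP[_ dF]; congr (_ * _).
rewrite -gA setIUl (setIidPl FA); move: dF; rewrite -setI_eq0 => /eqP->.
by rewrite setU0.
Qed.

Lemma depends_on_subset S : depends_on S (fun F => (S \subset F)%:R).
Proof. by move=> F; rewrite subsetI subxx andbT. Qed.

Lemma depends_on_mem f : depends_on [set f] (fun F => (f \in F)%:R).
Proof. by move=> F; rewrite !inE eqxx andbT. Qed.

Lemma expect_subset p E S : S \subset E ->
  expect p E (fun F => (S \subset F)%:R) = p ^+ #|S|.
Proof.
move=> SE; rewrite (expect_depends p SE (@depends_on_subset S)) /expect.
rewrite (bigD1 S) ?powersetE //= big1 => [|F /andP[]].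
  rewrite subxx mulr1 addr0 /weight.
  by rewrite (eq_bigr (fun=> p)) ?prodr_const // => f ->.
by rewrite powersetE eqEsubset => -> /= /negbTE->; rewrite mulr0.
Qed.

Lemma expect_mem p E f : f \in E -> expect p E (fun F => (f \in F)%:R) = p.
Proof.
move=> fE; rewrite -[RHS]expr1 -(cards1 f) -(@expect_subset p E) ?sub1set //.
by apply: eq_expect => F; rewrite sub1set.
Qed.

Lemma expect_compl p E g : expect p E (fun F => 1 - g F) = 1 - expect p E g.
Proof.
rewrite -[in RHS](expect_cst p E 1) -mulN1r -expectZ -expectD.
by apply: eq_expect => F; rewrite mulN1r.
Qed.

Lemma depends_on_compl A g : depends_on A g -> depends_on A (fun F => 1 - g F).
Proof. by move=> gA F; rewrite gA. Qed.

Lemma expect_prod_indep p E (I : finType) (s : {set I}) (A : I -> {set T})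
    (g : I -> {set T} -> R) :
  (forall i, i \in s -> depends_on (A i) (g i)) ->
  (forall i j, i \in s -> j \in s -> i != j -> [disjoint A i & A j]) ->
  expect p E (fun F => \prod_(i in s) g i F) = \prod_(i in s) expect p E (g i).
Proof.
elim/set_induction: s => [|i s si IHs] gA dA.
  rewrite big_set0 -[RHS](expect_cst p E).
  by apply: eq_expect => F; rewrite big_set0.
rewrite big_setU1 //= -IHs; first last.
- by move=> j l js ls; apply: dA; rewrite inE ?js ?ls orbT.
- by move=> j js; apply: gA; rewrite inE js orbT.
rewrite -(@expect_indep _ _ (A i) (\bigcup_(j in s) A j)).
- by apply: eq_expect => F; rewrite big_setU1.
- by apply: gA; rewrite setU11.
- move=> F; apply: eq_bigr => j js.
  apply: (@depends_onW (A j)); last by apply: gA; rewrite inE js orbT.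
  exact: bigcup_sup.
- apply: bigcup_disjoint => j js; apply: dA; rewrite ?setU11 ?inE ?js ?orbT //.
  by apply: contraNneq si => ->.
Qed.

End Expectation.

(** * Non-backtracking walks and girth *)

Section Walks.
Variable G : sgraph.
Implicit Types (x y z u v : G) (s t : seq G) (F C : {set {set G}}).

Lemma mem_edges x y : ([set x; y] \in edges G) = sedge x y.
Proof.
apply/imsetP/idP => [[[u v]]|xy]; last by exists (x, y).
rewrite inE /= => uv /setP xyuv.
have nuv : u != v by apply: contraTneq uv => ->; rewrite sedge_irrefl.
have := xyuv u; have := xyuv v; rewrite !inE !eqxx orbT /=.
move=> /orP[]/eqP Ev /orP[]/eqP Eu; move: uv nuv; rewrite Eu Ev ?eqxx //.
by rewrite sedge_sym.
Qed.

Fixpoint nbwalk s : bool :=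
  if s is a :: s' then
    if s' is b :: t then
      [&& sedge a b, (if t is c :: _ then a != c else true) & nbwalk s']
    else true
  else true.

Lemma nbwalk_behead a s : nbwalk (a :: s) -> nbwalk s.
Proof. by case: s => // b s /and3P[]. Qed.

Lemma nbwalk_path a s : nbwalk (a :: s) -> path (@sedge G) a s.
Proof.
elim: s a => //= b s IHs a /and3P[ab _ bs].
by rewrite ab; apply: IHs.
Qed.

(** A girth bound in natural numbers; an acyclic graph satisfies it for every [m]. *)
Definition girth_gt m := forall c : seq G, is_cycle c -> (m < size c)%N.

Lemma girth_gtW m k : (k <= m)%N -> girth_gt m -> girth_gt k.
Proof. by move=> km gm c /gm; apply: leq_ltn_trans. Qed.

(** If the tail has no repetition, a return to the head [a] closes a cycle of length at most [m]. *)
Lemma nbwalk_uniq m s :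
  girth_gt m -> nbwalk s -> (size s <= m.+1)%N -> uniq s.
Proof.
move=> gm; elim: s => //= a s IHs nbs; rewrite ltnS => sm.
have us : uniq s by apply: IHs (nbwalk_behead nbs) (leqW sm).
rewrite us andbT; apply/negP => /splitPr sP.
case: sP us sm nbs => s1 s2 us sm nbs.
have : is_cycle (a :: s1).
  split.
    (* A return after one step would be a loop, after two steps a backtrack. *)
    case: s1 nbs {us sm} => [|b [|? ?]] //=; first by rewrite sedge_irrefl.
    by rewrite eqxx andbF.
  rewrite /ucycle /= rcons_path.
  have := nbwalk_path nbs; rewrite cat_path /= => /and3P[-> -> _] /=.
  move: us; rewrite cat_uniq /= => /and3P[-> H _].
  by rewrite andbT; apply: contra H => as1; apply/orP; left.
move=> /gm; rewrite ltnNge => /negP[].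
by rewrite /= (leq_trans _ sm) // size_cat /= addnS ltnS leq_addr.
Qed.

(** Joins two walks from [y] with different first steps, one of them reversed; [take 1 t] covers an
    empty [t]. *)
Lemma nbwalk_catrev y u s t : nbwalk (y :: u :: s) -> nbwalk (y :: t) ->
  u \notin take 1 t -> nbwalk (catrev (u :: s) (y :: t)).
Proof.
elim: s u y t => [|v s IHs] u y t; rewrite [catrev _ _]/=.
  move=> /= /andP[yu _] yt ut; rewrite sedge_sym yu yt andbT /=.
  by case: t ut {yt} => //= c t; rewrite take0 inE.
move=> nb yt ut; apply: IHs.
- exact: nbwalk_behead nb.
- move: nb => /= /andP[yu _]; move: yt ut; rewrite /= sedge_sym yu => ->.
  by case: t => //= c t; rewrite take0 inE andbT.
- by move: nb => /= /and3P[_ yv _]; rewrite take0 inE eq_sym.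
Qed.

(* [reach F k z y]: some non-backtracking walk of length [k] from [y], all of
   whose edges are in [F], does not start towards [z]; [cone k z y] collects the
   edges that this depends on. *)
Fixpoint reach F k z y : bool :=
  if k is k'.+1 then
    [exists u, [&& sedge y u, u != z, [set y; u] \in F & reach F k' y u]]
  else true.

Fixpoint cone k z y : {set {set G}} :=
  if k is k'.+1 then
    \bigcup_(u | sedge y u && (u != z)) ([set y; u] |: cone k' y u)
  else set0.

Lemma reach_cone F C k z y :
  cone k z y \subset C -> reach (F :&: C) k z y = reach F k z y.
Proof.
elim: k z y => //= k IHk z y /bigcupsP sC; apply: eq_existsb => u.
case yu : (sedge y u) => //=; case uz : (u != z) => //=.
have := sC u; rewrite yu uz => /(_ isT); rewrite subUset sub1set => /andP[fC cC].
by rewrite inE fC andbT IHk.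
Qed.

(** Some walk from [y] through [u] traverses [f] last; this turns a coincidence of edges into a
    repeated vertex. *)
Lemma cone_walk f k y u : sedge y u -> f \in [set y; u] |: cone k y u ->
  exists s, [/\ (size s <= k)%N, nbwalk (y :: u :: s), last u s \in f
              & {subset f <= y :: u :: s}].
Proof.
move=> yu; rewrite inE => /orP[|].
  rewrite inE => /eqP->; exists [::]; split; rewrite //= ?yu //.
    by rewrite !inE eqxx orbT.
  by move=> v; rewrite !inE.
elim: k y u yu => [|k IHk] y u yu /=; first by rewrite inE.
move=> /bigcupP[v /andP[uv vy]]; rewrite in_setU1 => /orP[/eqP->|].
  exists [:: v]; split; rewrite //= ?yu ?uv 1?eq_sym ?vy //.
    by rewrite !inE eqxx orbT.
  by move=> w; rewrite !inE => /orP[]->; rewrite ?orbT.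
move=> /(IHk _ _ uv)[s [sk nb ls sf]]; exists (v :: s); split=> //.
  by move: nb; rewrite /= yu eq_sym vy.
by move=> w /sf ws; rewrite inE ws orbT.
Qed.

(** With a shared edge, the two walks leading to it could be joined at [y] into a non-backtracking
    walk on at most [k.*2 + 3] vertices with a repetition. *)
Lemma cone_disjoint k y u v : girth_gt k.*2.+2 ->
  sedge y u -> sedge y v -> u != v ->
  [disjoint [set y; u] |: cone k y u & [set y; v] |: cone k y v].
Proof.
move=> gk yu yv uv; rewrite disjoint_subset; apply/subsetP => f fu.
rewrite inE /=; apply/negP => fv.
have [s [sk nbs ls _]] := cone_walk yu fu.
have [t [tk nbt _ ft]] := cone_walk yv fv.
have : uniq (rev (u :: s) ++ [:: y, v & t]).
  apply: (nbwalk_uniq gk).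
    by rewrite -catrevE nbwalk_catrev //= take0 inE.
  by rewrite size_cat size_rev /= !addnS addSn !ltnS -addnn leq_add.
rewrite cat_uniq => /and3P[_ /hasPn/(_ _ (ft _ ls))].
by rewrite /= mem_rev mem_last.
Qed.

(** Otherwise a short non-backtracking walk leaving [y] through [u] would come back to [y]. *)
Lemma edge_notin_cone k y u : girth_gt k.+2 -> sedge y u ->
  [set y; u] \notin cone k y u.
Proof.
case: k => [|k] gk yu; first by rewrite inE.
apply/negP => /bigcupP[v /andP[uv vy] fv].
have [s [sk nb _ sf]] := cone_walk uv fv.
have : uniq (y :: u :: v :: s).
  apply: (nbwalk_uniq gk); last by rewrite /= !ltnS (leq_trans sk).
  by move: nb; rewrite /= yu eq_sym vy.
by rewrite cons_uniq sf // !inE eqxx.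
Qed.

Lemma reach_walk F k z y : reach F k z y ->
  exists s, [/\ size s = k, nbwalk (y :: s), z \notin take 1 s
              & path (spanning_edge F) y s].
Proof.
elim: k z y => [|k IHk] z y /=; first by exists [::].
move=> /existsP[u /and4P[yu uz fF /IHk[s [sk nb ys ps]]]].
exists (u :: s); rewrite /= sk take0 inE eq_sym uz; split=> //.
  by rewrite yu; move: nb => /= ->; case: s ys {sk ps} => //= v s; rewrite take0 inE andbT.
by rewrite /spanning_edge yu fF.
Qed.

Lemma reach_component F k z y : girth_gt k -> reach F k z y ->
  (k < #|[set x | connect (spanning_edge F) y x]|)%N.
Proof.
move=> gk /reach_walk[s [sk nb _ ps]].
have us : uniq (y :: s) by apply: (nbwalk_uniq gk) nb _; rewrite /= sk.
have <- : size (y :: s) = k.+1 by rewrite /= sk.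
rewrite -(card_uniqP us); apply: subset_leq_card; apply/subsetP => x xs.
by rewrite inE; apply: (path_connect ps).
Qed.

(** For [2 <= d] a non-backtracking walk can always be prolonged, and the girth bound makes [m.+1]
    successive vertices distinct. Hence growing girth forces growing order. *)
Lemma card_gt_girth d m : (2 <= d)%N -> regular d G -> girth_gt m ->
  (m < #|G|)%N.
Proof.
move=> d2 reg gm.
have nbr x y : exists u, sedge x u /\ u != y.
  have : (0 < #|[set u | sedge x u] :\ y|)%N.
    have := cardsD1 y [set u | sedge x u]; rewrite [X in X = _](reg x) => E.
    move: d2; rewrite E; case: (_ \in _) => //=.
    by rewrite add0n => /ltnW.
  by case/card_gt0P => u; rewrite !inE => /andP[? ?]; exists u.
have /card_gt0P[x0 _] := svertex_gt0 G.
have [s [ss nbs]] : exists s : seq G, size s = m.+1 /\ nbwalk s.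
  elim: {gm} m => [|m [s [ss nbs]]]; first by exists [:: x0].
  case: s ss nbs => // a s ss nbs; have [u [au us]] := nbr a (head x0 s).
  exists (u :: a :: s); split; first by rewrite /= -ss.
  by move: nbs us => /= ->; rewrite sedge_sym au andbT; case: s {ss} => //= c s ->.
have us := nbwalk_uniq gm nbs; rewrite -ss -(card_uniqP (us _)) ?ss //.
exact: max_card.
Qed.

End Walks.

(** * Local supercritical growth *)

Lemma card_bigcup_le (T I : finType) (P : pred I) (B : I -> {set T}) c :
  (forall i, P i -> #|B i| <= c)%N ->
  (#|\bigcup_(i | P i) B i| <= #|[pred i | P i]| * c)%N.
Proof.
move=> Bc; rewrite -sum_nat_const.
apply: (@leq_trans (\sum_(i | P i) #|B i|)); last exact: leq_sum.
elim/big_rec2 : _ => [|i m B' _ IH]; first by rewrite cards0.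
by rewrite (leq_trans (leq_card_setU _ _).1) // leq_add2l.
Qed.

(** Division-free form of a Bernoulli inequality, serving both the fixed point of the branching
    recursion and the decay of powers. *)
Lemma exprB1_le (R : realFieldType) (a : R) m : 0 <= a <= 1 ->
  (1 - a) ^+ m * (1 + m%:R * a) <= 1.
Proof.
move=> /andP[a0 a1]; elim: m => [|m IHm]; first by rewrite expr0 mul0r addr0 mulr1.
apply: le_trans IHm; rewrite exprSr -mulrA ler_wpM2l ?exprn_ge0 ?subr_ge0 //.
have m0 : 0 <= m%:R :> R by rewrite ler0n.
rewrite -natr1; nra.
Qed.

(** * Second moment bound under local dependence *)

Section Chebyshev.
Variables (R : realType) (T I : finType) (p : R) (E : {set T}).
Variables (X : I -> {set T} -> R) (A : I -> {set T}) (c : nat).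
Hypothesis p01 : 0 <= p <= 1.
Hypothesis X01 : forall i F, 0 <= X i F <= 1.
Hypothesis XA : forall i, depends_on (A i) (X i).
Hypothesis nearA : forall i, (#|[set j | ~~ [disjoint A i & A j]]| <= c)%N.

Lemma expect_01 (g : {set T} -> R) : (forall F, 0 <= g F <= 1) ->
  0 <= expect p E g <= 1.
Proof.
move=> g01; apply/andP; split.
  by rewrite -(expect_cst p E 0); apply: le_expect => // F _; case/andP: (g01 F).
by rewrite -(expect_cst p E 1); apply: le_expect => // F _; case/andP: (g01 F).
Qed.

(** Covariances vanish for disjoint supports and are at most 1 otherwise; each index meets at most
    [c] supports. *)
Lemma variance_le :
  expect p E (fun F => (\sum_i X i F - \sum_i expect p E (X i)) ^+ 2) <=
  (#|I| * c)%:R.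
Proof.
pose Y i F := X i F - expect p E (X i).
have EY i : expect p E (Y i) = 0.
  by rewrite (expectD p E (X i) (fun=> - expect p E (X i))) expect_cst subrr.
rewrite (@eq_expect _ _ _ _ _ (fun F => \sum_i \sum_j Y i F * Y j F)); last first.
  move=> F; rewrite -sumrB expr2 mulr_suml; apply: eq_bigr => i _.
  by rewrite mulr_sumr.
rewrite expect_sum mulnC natrM mulr_natr -sumr_const; apply: ler_sum => i _.
rewrite expect_sum (bigID (fun j => [disjoint A i & A j])) /= big1 ?add0r; last first.
  move=> j dij.
  have dep l : depends_on (A l) (Y l) by move=> F; rewrite /Y XA.
  by rewrite (expect_indep _ _ (dep i) (dep j)) // EY mul0r.
apply: (@le_trans _ _ #|[set j | ~~ [disjoint A i & A j]]|%:R); last first.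
  by rewrite ler_nat nearA.
rewrite -sum1_card natr_sum big_set.
apply: ler_sum => j _; rewrite -[leRHS](expect_cst p E); apply: le_expect => // F _.
have := expect_01 (X01 i); have := expect_01 (X01 j).
have := X01 i F; have := X01 j F; rewrite /Y.
move: (X i F) (X j F) (expect _ _ _) (expect _ _ _) => x y a b.
by move=> /andP[? ?] /andP[? ?] /andP[? ?] /andP[? ?]; nra.
Qed.

Lemma chebyshev (a : R) : 0 < a ->
  (forall i, a <= expect p E (X i)) -> (0 < #|I|)%N ->
  expect p E (fun F => (\sum_i X i F < a * #|I|%:R / 2)%R%:R) <=
  4 * c%:R / (a ^+ 2 * #|I|%:R).
Proof.
move=> a0 aX I0; have N0 : 0 < #|I|%:R :> R by rewrite ltr0n.
have mu : a * #|I|%:R <= \sum_i expect p E (X i).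
  by rewrite mulr_natr -sumr_const; apply: ler_sum.
have D0 : 0 < (a * #|I|%:R) ^+ 2 by rewrite exprn_gt0 ?mulr_gt0.
apply: (@le_trans _ _ (4 / (a * #|I|%:R) ^+ 2 * (#|I| * c)%:R)); last first.
  rewrite natrM le_eqVlt; apply/orP; left; apply/eqP; field.
  by rewrite !gt_eqF.
apply: le_trans (ler_wpM2l _ variance_le); last by rewrite divr_ge0 // ltW.
rewrite -expectZ; apply: le_expect => // F _.
move: (\sum_i X i F) (\sum_i expect _ _ _) mu => y m mu.
rewrite [leRHS]mulrAC ler_pdivlMr //.
have t0 : 0 < a * #|I|%:R by rewrite mulr_gt0.
move: (a * #|I|%:R) t0 mu {D0} => t t0 mu.
case: (ltP y) => hy; rewrite ?mul1r ?mul0r; last by rewrite mulr_ge0 ?sqr_ge0.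
(* Since [y < t / 2] and [t <= m], both factors are nonnegative; expanded, this is
   [t ^+ 2 <= 4 * (y - m) ^+ 2]. *)
have : 0 <= (2 * (m - y) - t) * (2 * (m - y) + t) by apply: mulr_ge0; lra.
by rewrite !expr2; lra.
Qed.

End Chebyshev.

(** * Branching recursion below the girth *)

Section Branching.
Variables (R : realType) (G : sgraph) (d : nat).
Hypothesis reg : regular d G.
Implicit Types (x y z u v : G).

Lemma reach_depends k z y :
  depends_on (cone k z y) (fun F => (reach F k z y)%:R : R).
Proof. by move=> F; rewrite reach_cone. Qed.

(** The branches at [y] use disjoint edge sets, so their failures are independent, each of
    probability at most [1 - p * a] by induction. The hypothesis on [a] closes the recursion with a
    bound independent of [k]. *)
Lemma reach_prob (p a : R) k z y : 0 <= p <= 1 -> 0 <= a <= 1 ->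
  (1 - p * a) ^+ d.-1 <= 1 - a -> girth_gt G k.*2 ->
  a <= expect p (edges G) (fun F => (reach F k z y)%:R).
Proof.
move=> p01 a01 pa; elim: k z y => [|k IHk] z y gk.
  by rewrite expect_cst; case/andP: a01.
have gk0 : girth_gt G k.*2 by apply: girth_gtW gk; rewrite doubleS leqW.
pose N := [set u | sedge y u && (u != z)].
pose g u (F : {set {set G}}) : R :=
  1 - ([set y; u] \in F)%:R * (reach F k y u)%:R.
have -> : expect p (edges G) (fun F => (reach F k.+1 z y)%:R) =
  expect p (edges G) (fun F => 1 - \prod_(u in N) g u F).
  apply: eq_expect => F; case: (boolP (reach F k.+1 z y)).
    move=> /= /existsP[u /and4P[yu uz yuF ru]]; rewrite (bigD1 u) ?inE ?yu //=.
    by rewrite {1}/g yuF ru mulr1 subrr mul0r subr0.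
  rewrite /= negb_exists => /forallP H; rewrite big1 ?subrr // => u.
  rewrite inE => /andP[yu uz]; have := H u; rewrite yu uz /g /=.
  by case: (_ \in F) => /=; rewrite ?mul0r ?subr0 // => /negbTE->; rewrite mulr0 subr0.
rewrite expect_compl (@expect_prod_indep _ _ _ _ _ _ (fun u => [set y; u] |: cone k y u)); last 2 first.
- move=> u _; apply: depends_on_compl; apply: depends_onM (@reach_depends _ _ _).
  exact: depends_on_mem.
- move=> u v; rewrite !inE => /andP[yu _] /andP[yv _].
  by apply: cone_disjoint; rewrite -?doubleS.
rewrite lerBrDr -lerBrDl (le_trans _ pa) //.
have pa0 : 0 <= 1 - p * a.
  by case/andP: p01 a01 => ? ? /andP[? ?]; nra.
apply: (@le_trans _ _ ((1 - p * a) ^+ #|N|)).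
  rewrite -prodr_const; apply: ler_prod => u; rewrite inE => /andP[yu uz].
  have Eg : expect p (edges G) (g u) =
      1 - p * expect p (edges G) (fun F => (reach F k y u)%:R).
    rewrite expect_compl (@expect_indep _ _ _ _ [set [set y; u]] (cone k y u)).
    - by rewrite expect_mem ?mem_edges.
    - exact: depends_on_mem.
    - exact: reach_depends.
    - rewrite disjoints1 edge_notin_cone //; apply: girth_gtW gk.
      by rewrite doubleS !ltnS -addnn leq_addr.
  have := IHk y u gk0; move=> ar.
  have /andP[r0 r1] : 0 <= expect p (edges G) (fun F => (reach F k y u)%:R) <= 1.
    by apply: expect_01 => // F; case: (reach _ _ _ _); rewrite ?lexx ?ler01.
  rewrite Eg; case/andP: p01 => p0 p1; apply/andP; split; nra.
(* Excluding [z] loses at most one neighbour, and none at a root, where [z = y]. *)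
have Nd : (d.-1 <= #|N|)%N.
  have := cardsD1 z [set u | sedge y u]; rewrite [X in X = _](reg y) => ->.
  have -> : N = [set u | sedge y u] :\ z by apply/setP => u; rewrite !inE andbC.
  by case: (_ \in _) => //=; rewrite add0n leq_pred.
apply: ler_wiXn2l => //; case/andP: p01 a01 => ? ? /andP[? ?]; nra.
Qed.

Fixpoint ball r x : {set G} :=
  if r is r'.+1 then x |: \bigcup_(u | sedge x u) ball r' u else [set x].

Lemma ball_center r x : x \in ball r x.
Proof. by case: r => [|r] /=; rewrite !inE eqxx. Qed.

Lemma ball_step r x u y : sedge x u -> y \in ball r u -> y \in ball r.+1 x.
Proof.
by move=> xu yu; rewrite /= in_setU; apply/orP; right; apply/bigcupP; exists u.
Qed.

Lemma ball_stepr r x y w : y \in ball r x -> sedge y w -> w \in ball r.+1 x.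
Proof.
elim: r x => [|r IHr] x.
  by rewrite inE => /eqP-> xw; apply: ball_step xw (ball_center 0 w).
rewrite [ball r.+1 x]/= in_setU1 => /orP[/eqP->|/bigcupP[u xu yu]] yw.
  exact: ball_step yw (ball_center _ _).
exact: ball_step xu (IHr _ yu yw).
Qed.

Lemma ball_sym r x y : y \in ball r x -> x \in ball r y.
Proof.
elim: r x y => [|r IHr] x y; first by rewrite !inE eq_sym.
rewrite [ball r.+1 x]/= in_setU1 => /orP[/eqP->|/bigcupP[u xu /IHr uy]].
  exact: ball_center.
by apply: ball_stepr uy _; rewrite sedge_sym.
Qed.

Lemma card_ball r x : (#|ball r x| <= d.+1 ^ r)%N.
Proof.
elim: r x => [|r IHr] x; first by rewrite cards1.
rewrite [ball r.+1 x]/= (leq_trans (leq_card_setU _ _).1) // cards1.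
rewrite expnS mulSn leq_add ?expn_gt0 //.
apply: leq_trans (card_bigcup_le (fun u _ => IHr u)) _.
rewrite leq_mul2r -(reg x) /degree cardsE; apply/orP; right.
by apply: subset_leq_card; apply/subsetP => u.
Qed.

Lemma cone_ball f k z y : f \in cone k z y -> f != set0 /\ f \subset ball k y.
Proof.
elim: k z y => [|k IHk] z y; first by rewrite inE.
move=> /bigcupP[u /andP[yu _]]; rewrite in_setU1 => /orP[/eqP->|/IHk[f0 fb]].
  split; first by apply/set0Pn; exists y; rewrite !inE eqxx.
  apply/subsetP => v; rewrite in_set2 => /orP[]/eqP->; first exact: ball_center.
  exact: ball_step yu (ball_center _ _).
by split=> //; apply/subsetP => v /(subsetP fb); apply: ball_step.
Qed.

(** Cones sharing an edge share a vertex, which lies within distance [k] of both roots. *)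
Lemma card_near_cones k x :
  (#|[set y : G | ~~ [disjoint cone k x x & cone k y y]]| <= d.+1 ^ k.*2)%N.
Proof.
apply: (@leq_trans #|\bigcup_(a in ball k x) ball k a|).
  apply: subset_leq_card; apply/subsetP => y; rewrite inE => /pred0Pn[f /=].
  move=> /andP[/cone_ball[/set0Pn[a af] /subsetP/(_ a af) ax]].
  move=> /cone_ball[_ /subsetP/(_ a af) ay].
  by apply/bigcupP; exists a => //; apply: ball_sym.
apply: leq_trans (card_bigcup_le (fun u _ => card_ball k u)) _.
by rewrite -addnn expnD leq_mul2r card_ball orbT.
Qed.

(** For fixed [k] the dependence range is bounded, so the error vanishes as [#|G|] grows. *)
Lemma reach_concentration (p a : R) k : 0 <= p <= 1 -> 0 < a <= 1 ->
  (1 - p * a) ^+ d.-1 <= 1 - a -> girth_gt G k.*2 ->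
  expect p (edges G)
    (fun F => (#|[set x | reach F k x x]|%:R < a * #|G|%:R / 2)%R%:R) <=
  4 * (d.+1 ^ k.*2)%:R / (a ^+ 2 * #|G|%:R).
Proof.
move=> p01 /andP[a0 a1] pa gk.
rewrite (@eq_expect _ _ _ _ _ (fun F =>
  (\sum_(x : G) (reach F k x x)%:R < a * #|G|%:R / 2)%R%:R)); last first.
  move=> F; rewrite -sum1dep_card natr_sum big_mkcond /=.
  rewrite (eq_bigr (fun x => (reach F k x x)%:R)) // => x _.
  by case: (reach _ _ _ _).
apply: (@chebyshev _ _ _ _ _ _ (fun x => cone k x x)) => //.
- by move=> x F; case: (reach _ _ _ _); rewrite ?lexx ?ler01.
- by move=> x; apply: reach_depends.
- exact: card_near_cones.
- by move=> x; apply: reach_prob; rewrite ?(ltW a0).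
- exact: svertex_gt0.
Qed.

End Branching.

(** * Links between large sets in an expander *)

Section Expansion.
Variables (R : realType) (G : sgraph) (d : nat) (b : R).
Hypothesis reg : regular d G.
Hypothesis d_gt0 : (0 < d)%N.
Hypothesis b_gt0 : 0 < b.
Hypothesis iso : forall A : {set G}, (0 < #|A|)%N -> (2 * #|A| <= #|G|)%N ->
  b * #|A|%:R <= #|edges_between A (~: A)|%:R.
Implicit Types (A B : {set G}) (F S D : {set {set G}}).

Definition linked F A B :=
  [exists x in A, exists y in B, connect (spanning_edge F) x y].

Lemma connect_spanning_sub F S x y : F \subset S ->
  connect (spanning_edge F) x y -> connect (spanning_edge S) x y.
Proof.
move=> FS; apply: connect_sub => {x y} x y /andP[xy xyF].
by apply: connect1; rewrite /spanning_edge xy (subsetP FS).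
Qed.

Lemma connect_spanning_sym F : connect_sym (spanning_edge F).
Proof. exact/sym_connect_sym/spanning_edge_sym. Qed.

(** Closed neighbourhood of [A] once the edges in [D] are deleted. *)
Definition enlarge D A : {set G} :=
  A :|: [set v | [exists u in A, sedge u v && ([set u; v] \notin D)]].

(** Each boundary edge of [A] is in [D] or ends at a new vertex, and a new vertex absorbs at most
    [d] of them. *)
Lemma enlarge_card D A : (0 < #|A|)%N -> (2 * #|A| <= #|G|)%N ->
  b * #|A|%:R + d%:R * #|A|%:R <= #|D|%:R + d%:R * #|enlarge D A|%:R.
Proof.
move=> A0 AN.
have sA : A \subset enlarge D A by apply: subsetUl.
rewrite -(cardsID A (enlarge D A)) (setIidPr sA) natrD.
suff : b * #|A|%:R <= #|D|%:R + d%:R * #|enlarge D A :\: A|%:R by lra.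
apply: le_trans (iso A0 AN) _; rewrite -natrM -natrD ler_nat mulnC.
apply: (@leq_trans #|D :|: \bigcup_(v in enlarge D A :\: A)
                          [set [set v; u] | u in [set u | sedge v u]]|).
  apply: subset_leq_card; apply/subsetP => f.
  rewrite inE => /andP[fE /existsP[x /andP[xA /existsP[y]]]].
  rewrite inE => /andP[yA /eqP Ef]; rewrite in_setU; case fD : (f \in D) => //=.
  have xy : sedge x y by rewrite -mem_edges -Ef.
  apply/bigcupP; exists y.
    rewrite !inE yA /=; apply/orP; right; apply/existsP; exists x.
    by rewrite xA xy -Ef fD.
  by apply/imsetP; exists x; rewrite ?inE 1?sedge_sym // Ef setUC.
rewrite (leq_trans (leq_card_setU _ _).1) // leq_add2l.
apply: leq_trans (card_bigcup_le (c := d) _) _ => [v _|].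
  by rewrite (leq_trans (leq_imset_card _ _)) // -(reg v).
by rewrite leq_mul2r; apply/orP; right; apply: subset_leq_card; apply/subsetP.
Qed.

Lemma iter_enlarge_sub D A i : A \subset iter i (enlarge D) A.
Proof.
by elim: i => //= i IHi; apply: subset_trans IHi (subsetUl _ _).
Qed.

(** Up to half of the vertices, [D] spoils at most half of the expansion, so each round gains at
    least [b * a * #|G| / (2 * d)] vertices; [l] rounds of this would exceed [#|G| / 2]. *)
Lemma iter_enlarge_card D A (a : R) l : 0 < a -> a * #|G|%:R <= #|A|%:R ->
  2 * #|D|%:R <= b * a * #|G|%:R -> d%:R < l%:R * (b * a) ->
  (#|G| < 2 * #|iter l (enlarge D) A|)%N.
Proof.
move=> a0 aA Da lda; have N0 : 0 < #|G|%:R :> R by rewrite ltr0n svertex_gt0.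
have d0 : 0 < d%:R :> R by rewrite ltr0n.
rewrite ltnNge; apply/negP => small.
have smallW i : (i <= l)%N -> (2 * #|iter i (enlarge D) A| <= #|G|)%N.
  move=> il; apply: leq_trans small; rewrite leq_mul2l /=; apply: subset_leq_card.
  by rewrite -(subnK il) iterD iter_enlarge_sub.
have grow i : (i <= l)%N ->
    i%:R * (b * a * #|G|%:R) <= 2 * d%:R * #|iter i (enlarge D) A|%:R.
  elim: i => [|i IHi] il; first by rewrite mul0r mulr_ge0 ?ler0n // mulr_ge0 ?ltW.
  have := IHi (ltnW il); have := smallW i (ltnW il).
  rewrite iterS; set B := iter i _ A => sB.
  have aB : a * #|G|%:R <= #|B|%:R.
    apply: le_trans aA _; rewrite ler_nat subset_leq_card //.
    exact: iter_enlarge_sub.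
  have B0 : (0 < #|B|)%N.
    by rewrite -(ltr0n R) (lt_le_trans _ aB) // mulr_gt0.
  have := enlarge_card D B0 sB; rewrite -natr1.
  have : b * (a * #|G|%:R) <= b * #|B|%:R by rewrite ler_pM2l.
  move: Da; lra.
have := grow l (leqnn l); have : 2 * #|iter l (enlarge D) A|%:R <= #|G|%:R :> R.
  by rewrite -natrM ler_nat.
move: #|_|%:R => n nN; rewrite mulrA => H.
have : d%:R * #|G|%:R < l%:R * (b * a) * #|G|%:R by rewrite ltr_pM2r.
have : d%:R * (2 * n) <= d%:R * #|G|%:R by rewrite ler_pM2l.
lra.
Qed.

Lemma iter_enlarge_connect D A i v : v \in iter i (enlarge D) A ->
  exists S, [/\ S \subset edges G :\: D, (#|S| <= i)%N
    & exists2 x, x \in A & connect (spanning_edge S) x v].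
Proof.
elim: i v => [|i IHi] v /=.
  by exists set0; rewrite sub0set cards0; split=> //; exists v.
rewrite in_setU => /orP[/IHi[S [SD Si xv]]|]; first by exists S; rewrite ltnW.
rewrite inE => /existsP[u /and3P[/IHi[S [SD Si [x xA xu]]] uv uvD]].
exists ([set u; v] |: S); split.
- by rewrite subUset SD sub1set inE uvD mem_edges uv.
- by rewrite (leq_trans (leq_card_setU _ _).1) // cards1 add1n ltnS.
- exists x => //; apply: connect_trans (connect_spanning_sub (subsetUr _ _) xu) _.
  by apply: connect1; rewrite /spanning_edge uv setU11.
Qed.

(** After [l] rounds both enlargements exceed half of the vertices, so they meet, and the two paths
    to a common vertex form the link. *)
Lemma short_link D A B (a : R) l : 0 < a ->
  a * #|G|%:R <= #|A|%:R -> a * #|G|%:R <= #|B|%:R ->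
  2 * #|D|%:R <= b * a * #|G|%:R -> d%:R < l%:R * (b * a) ->
  exists S, [/\ S \subset edges G :\: D, (#|S| <= l.*2)%N & linked S A B].
Proof.
move=> a0 aA aB Da lda.
have hA := iter_enlarge_card a0 aA Da lda.
have hB := iter_enlarge_card a0 aB Da lda.
have [v] : exists v, v \in iter l (enlarge D) A :&: iter l (enlarge D) B.
  apply/set0Pn; apply: contraTneq isT => I0.
  have := cardsUI (iter l (enlarge D) A) (iter l (enlarge D) B).
  rewrite I0 cards0 addn0 => E.
  have := leq_add hA hB; rewrite addSn addnS -mulnDr -E mul2n -addnn.
  move: (_ :|: _) => U UG; have := leq_trans UG (leq_add (max_card _) (max_card _)).
  by rewrite ltnNge leqnSn.
rewrite inE => /andP[/iter_enlarge_connect[S [SD Sl [x xA xv]]]].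
move=> /iter_enlarge_connect[S' [SD' Sl' [y yB yv]]].
exists (S :|: S'); split.
- by rewrite subUset SD SD'.
- by rewrite (leq_trans (leq_card_setU _ _).1) // -addnn leq_add.
apply/existsP; exists x; rewrite xA; apply/existsP; exists y; rewrite yB /=.
apply: connect_trans (connect_spanning_sub (subsetUl _ _) xv) _.
by rewrite connect_spanning_sym (connect_spanning_sub (subsetUr _ _) yv).
Qed.

(* Greedily collecting edge-disjoint short links between [A] and [B]: removing
   the edges used so far leaves an expander, up to a small loss, hence yields one
   more link. *)
Lemma not_linked_majorant (e a : R) A B l j : 0 <= e <= 1 -> 0 < a ->
  a * #|G|%:R <= #|A|%:R -> a * #|G|%:R <= #|B|%:R ->
  d%:R < l%:R * (b * a) -> 2 * (l.*2 * j)%:R <= b * a * #|G|%:R ->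
  exists D h, [/\ (#|D| <= l.*2 * j)%N, depends_on D h,
    forall F, (~~ linked F A B)%:R <= h F
    & expect e (edges G) h <= (1 - e ^+ l.*2) ^+ j].
Proof.
move=> e01 a0 aA aB lda; elim: j => [|j IHj] jN.
  exists set0, (fun=> 1); rewrite cards0 expect_cst expr0; split=> // F.
  by case: linked; rewrite ?ler01.
have [|D [h [Dj hD hl he]]] := IHj.
  by apply: le_trans jN; rewrite ler_pM2l // ler_nat leq_mul2l leqnSn orbT.
have [|S [SD Sl lS]] := @short_link D A B a l a0 aA aB _ lda.
  apply: le_trans jN; rewrite ler_pM2l // ler_nat (leq_trans Dj) //.
  by rewrite leq_mul2l leqnSn orbT.
have dDS : [disjoint D & S].
  by move: SD; rewrite subsetD disjoint_sym => /andP[].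
have h0 F : 0 <= h F by apply: le_trans (hl F); rewrite ler0n.
have SE : S \subset edges G by move: SD; rewrite subsetD => /andP[].
(* The majorant is the indicator that every link collected so far has a missing edge; disjointness
   from [D] makes the new factor independent. *)
exists (D :|: S), (fun F => h F * (1 - (S \subset F)%:R)); split.
- by rewrite (leq_trans (leq_card_setU _ _).1) // mulnS addnC leq_add.
- by apply: depends_onM => //; apply: depends_on_compl; apply: depends_on_subset.
- move=> F; case SF : (S \subset F); last by rewrite subr0 mulr1.
  have -> : linked F A B; last by rewrite subrr mulr0.
  have /existsP[x /andP[xA /existsP[y /andP[yB xy]]]] := lS.
  apply/existsP; exists x; rewrite xA; apply/existsP; exists y; rewrite yB /=.
  exact: connect_spanning_sub xy.
have /andP[e0 e1] := e01.
rewrite (expect_indep e (edges G) hD _ dDS); last first.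
  by apply: depends_on_compl; apply: depends_on_subset.
rewrite expect_compl expect_subset // exprSr.
apply: ler_pM => //.
- by rewrite -(expect_cst e (edges G) 0); apply: le_expect.
- by rewrite subr_ge0 exprn_ile1.
- by rewrite lerD2l lerN2 ler_wiXn2l.
Qed.

Lemma not_linked_prob (e a : R) A B l j : 0 <= e <= 1 -> 0 < a ->
  a * #|G|%:R <= #|A|%:R -> a * #|G|%:R <= #|B|%:R ->
  d%:R < l%:R * (b * a) -> 2 * (l.*2 * j)%:R <= b * a * #|G|%:R ->
  expect e (edges G) (fun F => (~~ linked F A B)%:R) <= (1 - e ^+ l.*2) ^+ j.
Proof.
move=> e01 a0 aA aB lda jN.
have [D [h [_ _ hl]]] := not_linked_majorant e01 a0 aA aB lda jN.
by apply: le_trans; apply: le_expect.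
Qed.

End Expansion.

(** * Sprinkling *)

Lemma percolation_probE (R : realType) (p : R) (G : sgraph) (Q : pred sgraph) :
  percolation_prob p G Q =
  expect p (edges G) (fun F => (Q (spanning_subgraph F))%:R).
Proof.
rewrite /percolation_prob big_mkcondr; apply: eq_bigr => F _.
by case: (Q _); rewrite ?mulr1 ?mulr0.
Qed.

(** * Clusters and their splits *)

Section Clusters.
Variables (R : realType) (G : sgraph).
Implicit Types (F S : {set {set G}}) (V W : {set G}) (x y : G).

Definition cluster F x : {set G} := [set y | connect (spanning_edge F) x y].

Lemma cluster_eq F x y : y \in cluster F x -> cluster F y = cluster F x.
Proof.
rewrite inE => xy; apply/setP => w.
by rewrite !inE (same_connect (@connect_spanning_sym G F) xy).
Qed.

Lemma has_component_geP (c : R) F :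
  reflect (exists x, c * #|G|%:R <= #|cluster F x|%:R)
          (has_component_ge c (spanning_subgraph F)).
Proof.
apply: (iffP existsP) => [[C /andP[/imsetP[x _ ->] h]]|[x h]].
  by exists x.
by exists (cluster F x); rewrite h andbT; apply/imsetP; exists x.
Qed.

Definition large_clusters F k : {set {set G}} :=
  [set cluster F x | x in [set x | k <= #|cluster F x|]%N].

Lemma card_large_clusters F k : (#|large_clusters F k| * k <= #|G|)%N.
Proof.
apply: (@leq_trans #|cover (large_clusters F k)|); last exact: max_card.
have /eqP <- : trivIset (large_clusters F k).
  apply/trivIsetP => _ _ /imsetP[x _ ->] /imsetP[y _ ->].
  apply: contraR => /pred0Pn[z /= /andP[zx zy]].
  by rewrite -(cluster_eq zx) -(cluster_eq zy).
rewrite -sum_nat_const; apply: leq_sum => _ /imsetP[x xk ->].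
by rewrite inE in xk.
Qed.

Lemma mem_cover_large F k x :
  (x \in cover (large_clusters F k)) = (k <= #|cluster F x|)%N.
Proof.
apply/bigcupP/idP => [[_ /imsetP[y yk ->] /cluster_eq->]|xk].
  by rewrite inE in yk.
exists (cluster F x); last by rewrite inE connect0.
by apply/imsetP; exists x; rewrite ?inE.
Qed.

Definition connect_closed F V :=
  [forall x in V, [forall y, connect (spanning_edge F) x y ==> (y \in V)]].

Lemma connect_closedP F V :
  reflect (forall x y, x \in V -> connect (spanning_edge F) x y -> y \in V)
          (connect_closed F V).
Proof.
apply: (iffP forall_inP) => H x => [y xV xy|xV].
  by have /forallP/(_ y)/implyP := H x xV; apply.
by apply/forallP => y; apply/implyP; apply: H.
Qed.

(** Take [W] minimal among closed sets with at least [t] vertices in [V]. Removing one cluster, of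
    order below [t], drops it under [t], so [W] holds fewer than [2 * t] vertices of [V]. *)
Lemma split_closed F V (t : R) : 0 < t -> 3 * t <= #|V|%:R ->
  (forall x, #|cluster F x|%:R < t) ->
  exists W, [/\ connect_closed F W, t <= #|V :&: W|%:R & t <= #|V :\: W|%:R].
Proof.
move=> t0 Vt small.
pose P W := connect_closed F W && (t <= #|V :&: W|%:R).
have PT : P setT.
  rewrite /P setIT (le_trans _ Vt) ?andbT; last lra.
  by apply/connect_closedP => x y; rewrite !inE.
have [W /minsetP[/andP[cW tW] minW] _] := minset_exists PT.
exists W; split=> //.
have [x] : exists x, x \in V :&: W.
  by apply/set0Pn; apply: contraTneq tW => ->; rewrite cards0 -ltNge.
rewrite inE => /andP[xV xW].
have cW' : connect_closed F (W :\: cluster F x).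
  apply/connect_closedP => y z; rewrite !inE => /andP[xy yW] yz.
  rewrite (connect_closedP _ _ cW _ _ yW yz) andbT; apply: contra xy => xz.
  by apply: connect_trans xz _; rewrite connect_spanning_sym.
have : #|V :&: (W :\: cluster F x)|%:R < t.
  rewrite ltNge; apply/negP => tW'.
  have := minW (W :\: cluster F x); rewrite /P cW' tW' subsetDl => /(_ isT isT).
  by move=> /setP/(_ x); rewrite !inE connect0 xW.
have : (#|V :&: W| <= #|V :&: (W :\: cluster F x)| + #|cluster F x|)%N.
  apply: leq_trans (leq_card_setU _ _).1; apply: subset_leq_card.
  by apply/subsetP => y; rewrite !inE => /andP[-> ->] /=; case: connect.
rewrite -(ler_nat R) natrD; move: Vt; rewrite -(cardsID W V) natrD.
have := small x; lra.
Qed.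

(** Without a giant cluster, [split_closed] for [F :|: F'] yields a split of [V] that no path in
    [F'] crosses, so some summand equals 1. *)
Lemma no_giant_union_bound F F' k (c : R) (V := cover (large_clusters F k)) :
  0 < c -> 3 * (c * #|G|%:R) <= #|V|%:R ->
  (~~ has_component_ge c (spanning_subgraph (F :|: F')))%:R <=
  \sum_(U in powerset (large_clusters F k) |
        (c * #|G|%:R <= #|cover U|%:R) && (c * #|G|%:R <= #|V :\: cover U|%:R))
     (~~ linked F' (cover U) (V :\: cover U))%:R :> R.
Proof.
move=> c0 cV; case: has_component_geP => [_|ng] /=.
  by apply: sumr_ge0 => U _; rewrite ler0n.
have N0 : 0 < #|G|%:R :> R by rewrite ltr0n svertex_gt0.
have [|x|W [cW tW tW']] := @split_closed (F :|: F') V (c * #|G|%:R) _ cV.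
- exact: mulr_gt0.
- by rewrite ltNge; apply/negP => h; apply: ng; exists x.
have cl x y : x \in W -> connect (spanning_edge F) x y -> y \in W.
  move=> xW xy; apply: (connect_closedP _ _ cW _ _ xW).
  exact: connect_spanning_sub (subsetUl _ _) xy.
(* As [W] is closed under [F], each large cluster is inside [W] or disjoint from it, so [U] covers
   exactly [V :&: W]. *)
pose U := [set C in large_clusters F k | C \subset W].
have covU : cover U = V :&: W.
  apply/setP => x; rewrite in_setI; apply/bigcupP/andP.
    move=> [C]; rewrite inE => /andP[CL CW] xC; split; last exact: (subsetP CW).
    by apply/bigcupP; exists C.
  move=> [/bigcupP[C CL xC] xW]; exists C => //; rewrite inE CL /=.
  have /imsetP[y _ EC] := CL; apply/subsetP => z; rewrite EC in xC *.
  by rewrite -(cluster_eq xC) inE; apply: cl.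
have VU : V :\: cover U = V :\: W.
  by rewrite covU; apply/setP => x; rewrite !inE; case: (x \in V); rewrite ?andbF.
rewrite (bigD1 U) /=; last first.
  rewrite powersetE VU covU tW tW' !andbT; apply/subsetP => C.
  by rewrite inE => /andP[].
rewrite VU covU; case: (boolP (linked _ _ _)) => [|_]; last first.
  by rewrite lerDl; apply: sumr_ge0 => ? _; rewrite ler0n.
move=> /existsP[x /andP[]]; rewrite inE => /andP[_ xW] /existsP[y /andP[]].
rewrite inE => /andP[/negP yW _] xy; case: yW.
apply: (connect_closedP _ _ cW _ _ xW).
exact: connect_spanning_sub (subsetUr _ _) xy.
Qed.

End Clusters.

(** * Giant component after sprinkling *)

Section Giant.
Variables (R : realType) (G : sgraph) (d : nat) (b : R).
Hypothesis reg : regular d G.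
Hypothesis d_gt0 : (0 < d)%N.
Hypothesis b_gt0 : 0 < b.
Hypothesis iso : forall A : {set G}, (0 < #|A|)%N -> (2 * #|A| <= #|G|)%N ->
  b * #|A|%:R <= #|edges_between A (~: A)|%:R.

(** Union bound over the subsets of the at most [#|G| %/ k] large clusters, each split failing to be
    linked with small probability. *)
Lemma no_giant_sprinkled F (e c : R) k l j : 0 <= e <= 1 -> 0 < c ->
  (0 < k)%N -> 3 * (c * #|G|%:R) <= #|cover (large_clusters F k)|%:R ->
  d%:R < l%:R * (b * c) -> 2 * (l.*2 * j)%:R <= b * c * #|G|%:R ->
  expect e (edges G)
    (fun F' => (~~ has_component_ge c (spanning_subgraph (F :|: F')))%:R) <=
  2 ^+ (#|G| %/ k) * (1 - e ^+ l.*2) ^+ j.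
Proof.
move=> e01 c0 k0 cV ldc jN.
have q0 : 0 <= 1 - e ^+ l.*2.
  by case/andP: e01 => ? ?; rewrite subr_ge0 exprn_ile1.
apply: le_trans (le_expect e01 (fun F' _ => no_giant_union_bound F' c0 cV)) _.
rewrite expect_sum.
apply: (@le_trans _ _ (\sum_(U in powerset (large_clusters F k)) (1 - e ^+ l.*2) ^+ j)).
  rewrite big_mkcondr; apply: ler_sum => U _.
  case: ifP => [/andP[h1 h2]|_]; last exact: exprn_ge0.
  by apply: (not_linked_prob reg d_gt0 b_gt0 iso e01 c0).
rewrite sumr_const card_powerset -[leLHS]mulr_natl ler_wpM2r ?exprn_ge0 //.
rewrite natrX ler_eXn2l ?ltr1n // leq_divRL //.
exact: card_large_clusters.
Qed.

Lemma giant_prob (p r e a : R) k l j :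
  1 - p = (1 - r) * (1 - e) -> 0 <= r <= 1 -> 0 <= e <= 1 -> 0 < a <= 1 ->
  (1 - r * a) ^+ d.-1 <= 1 - a -> girth_gt G k.*2 -> (0 < k)%N ->
  d%:R < l%:R * (b * (a / 6)) -> 2 * (l.*2 * j)%:R <= b * (a / 6) * #|G|%:R ->
  1 - percolation_prob p G (has_component_ge (a / 6)) <=
  4 * (d.+1 ^ k.*2)%:R / (a ^+ 2 * #|G|%:R) +
  2 ^+ (#|G| %/ k) * (1 - e ^+ l.*2) ^+ j.
Proof.
move=> pre r01 e01 a01 ra gk k0 ldc jN.
have /andP[a0 a1] := a01.
rewrite percolation_probE -expect_compl (expect_sprinkle _ _ pre).
apply: le_trans (lerD (reach_concentration reg r01 a01 ra gk) (lexx _)).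
rewrite -(expect_cst r (edges G) (2 ^+ _ * _)) -expectD; apply: le_expect => // F _.
have q0 : 0 <= 2 ^+ (#|G| %/ k) * (1 - e ^+ l.*2) ^+ j.
  case/andP: e01 => ? ?; apply: mulr_ge0; first exact: exprn_ge0.
  by rewrite exprn_ge0 // subr_ge0 exprn_ile1.
have E : (fun F' : {set {set G}} =>
    1 - (has_component_ge (a / 6) (spanning_subgraph (F :|: F')))%:R : R) =1
   (fun F' => (~~ has_component_ge (a / 6) (spanning_subgraph (F :|: F')))%:R).
  by move=> F'; case: has_component_ge; rewrite ?subrr ?subr0.
rewrite (eq_expect _ _ E).
(* If too few vertices reach distance [k], the first error term is already 1 and the sprinkling is
   bounded trivially. *)
case: ltP => [_|big]; rewrite ?add0r.
  apply: (@le_trans _ _ 1); last by rewrite lerDl.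
  rewrite -[leRHS](expect_cst e (edges G)); apply: le_expect => // F' _.
  by case: has_component_ge; rewrite ?ler01.
apply: no_giant_sprinkled => //; first by rewrite divr_gt0.
(* The density [a / 6] is chosen so that three times it is the [a / 2] obtained from
   concentration. *)
apply: (@le_trans _ _ (a * #|G|%:R / 2)); first lra.
apply: le_trans big _; rewrite ler_nat; apply: subset_leq_card.
apply/subsetP => x; rewrite inE mem_cover_large => xk.
apply: ltnW; apply: reach_component xk; apply: girth_gtW gk.
by rewrite -addnn leq_addr.
Qed.

End Giant.

(** * Subcritical clusters *)

Section Subcritical.
Variables (R : realType) (G : sgraph) (d : nat) (p : R).
Hypothesis reg : regular d G.
Hypothesis p01 : 0 <= p <= 1.
Implicit Types (F C : {set {set G}}) (U V : {set G}) (x y u : G).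

(* Endpoints of the open self-avoiding walks of length [k] from [y] whose later
   vertices avoid [U]. *)
Fixpoint walk_ends F k U y : {set G} :=
  if k is k'.+1 then
    \bigcup_(u | [&& sedge y u, u \notin U & [set y; u] \in F])
      walk_ends F k' (y |: U) u
  else [set y].

(** A superset, independent of [k], of the edges on which [walk_ends F k U y] depends when
    [y \notin U]. *)
Definition avoiding U : {set {set G}} := [set f : {set G} | [disjoint f & U]].

Lemma avoiding_edge U y u : y \notin U -> u \notin U -> [set y; u] \in avoiding U.
Proof.
move=> yU uU; rewrite inE disjoint_subset; apply/subsetP => v.
by rewrite !inE => /orP[]/eqP->.
Qed.

Lemma avoidingS U V : U \subset V -> avoiding V \subset avoiding U.
Proof.
by move=> UV; apply/subsetP => f; rewrite !inE; apply: disjointWr.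
Qed.

Lemma walk_ends_avoiding F C k U y : y \notin U -> avoiding U \subset C ->
  walk_ends (F :&: C) k U y = walk_ends F k U y.
Proof.
elim: k U y => //= k IHk U y yU UC.
have E u : sedge y u -> u \notin U -> [set y; u] \in C.
  by move=> _ uU; rewrite (subsetP UC) // avoiding_edge.
apply: eq_big => [u|u /and3P[yu uU _]].
  rewrite inE; case yu : (sedge y u) => //=; case uU : (u \notin U) => //=.
  by rewrite E ?andbT.
apply: IHk.
  by rewrite !inE negb_or uU andbT; apply: contraTneq yu => ->; rewrite sedge_irrefl.
exact: subset_trans (avoidingS (subsetUr _ _)) UC.
Qed.

Lemma path_walk_ends F U y s : path (spanning_edge F) y s -> uniq (y :: s) ->
  {in s, forall v, v \notin U} -> last y s \in walk_ends F (size s) U y.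
Proof.
elim: s U y => [|u s IHs] U y /=; first by rewrite inE.
move=> /andP[/andP[yu yuF] ps] /and3P[yus us uns] sU.
apply/bigcupP; exists u; first by rewrite yu yuF sU ?mem_head.
apply: IHs => //=; first by rewrite us.
move=> v vs; rewrite !inE negb_or sU ?inE ?vs ?orbT // andbT.
by apply: contraNneq yus => <-; rewrite inE vs orbT.
Qed.

Lemma cluster_walk_ends F x :
  cluster F x \subset \bigcup_(k < #|G|) walk_ends F k set0 x.
Proof.
apply/subsetP => y; rewrite inE => /connectP[s ps ->].
have [s' ps' us' _] := shortenP ps.
have s'G : (size s' < #|G|)%N.
  by rewrite -[(size s').+1]/(size (x :: s')) -(card_uniqP us') max_card.
apply/bigcupP; exists (Ordinal s'G) => //=.
by apply: path_walk_ends => // v _; rewrite inE.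
Qed.

(** After its first edge the walk avoids [y], so its continuation is independent of that edge. *)
Lemma expect_walk_endsS k U y : y \notin U ->
  expect p (edges G) (fun F => #|walk_ends F k.+1 U y|%:R) <=
  \sum_(u | sedge y u && (u \notin U))
    p * expect p (edges G) (fun F => #|walk_ends F k (y |: U) u|%:R).
Proof.
move=> yU.
apply: (@le_trans _ _ (expect p (edges G) (fun F =>
  \sum_(u | sedge y u && (u \notin U))
     ([set y; u] \in F)%:R * #|walk_ends F k (y |: U) u|%:R))).
  apply: le_expect => // F _ /=.
  apply: (@le_trans _ _ (\sum_(u | [&& sedge y u, u \notin U & [set y; u] \in F])
     #|walk_ends F k (y |: U) u|)%N%:R).
    rewrite ler_nat; elim/big_rec2 : _ => [|u A m _ IH]; first by rewrite cards0.
    by rewrite (leq_trans (leq_card_setU _ _).1) // leq_add2l.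
  rewrite natr_sum big_mkcond [leRHS]big_mkcond; apply: ler_sum => u _.
  by case: sedge => //=; case: (u \notin U) => //=; case: (_ \in F); rewrite ?mul1r ?mul0r.
rewrite expect_sum; apply: ler_sum => u /andP[yu uU].
rewrite (@expect_indep _ _ _ _ [set [set y; u]] (avoiding (y |: U))).
- by rewrite expect_mem ?mem_edges.
- exact: depends_on_mem.
- move=> F; rewrite walk_ends_avoiding // !inE negb_or uU andbT.
  by apply: contraTneq yu => ->; rewrite sedge_irrefl.
- rewrite disjoints1 inE; apply/pred0Pn; exists y => /=.
  by rewrite !inE eqxx.
Qed.

(** The forbidden neighbour [w], from which the walk arrived, leaves at most [d.-1] continuations at
    each step. *)
Lemma expect_walk_ends k U y : y \notin U -> (exists2 w, w \in U & sedge y w) ->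
  expect p (edges G) (fun F => #|walk_ends F k U y|%:R) <= (d.-1%:R * p) ^+ k.
Proof.
have /andP[p0 _] := p01.
elim: k U y => [|k IHk] U y yU [w wU yw].
  by rewrite expr0 /= (eq_expect _ _ (h := fun=> 1)) ?expect_cst // => F; rewrite cards1.
apply: le_trans (expect_walk_endsS _ yU) _.
apply: (@le_trans _ _ (\sum_(u | sedge y u && (u \notin U)) p * (d.-1%:R * p) ^+ k)).
  apply: ler_sum => u /andP[yu uU]; rewrite ler_wpM2l // IHk //.
    rewrite !inE negb_or uU andbT.
    by apply: contraTneq yu => ->; rewrite sedge_irrefl.
  by exists y; rewrite ?setU11 // sedge_sym.
rewrite sumr_const -[leLHS]mulr_natl exprS mulrA ler_wpM2r //.
  by rewrite exprn_ge0 // mulr_ge0.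
rewrite ler_wpM2r // ler_nat.
have := cardsD1 w [set u | sedge y u]; rewrite [X in X = _](reg y) inE yw add1n => -> /=.
apply: subset_leq_card; apply/subsetP => u; rewrite !inE => /andP[-> uU].
by rewrite andbT; apply: contraNneq uU => ->.
Qed.

Lemma expect_walk_ends0 k x :
  expect p (edges G) (fun F => #|walk_ends F k.+1 set0 x|%:R) <=
  d%:R * p * (d.-1%:R * p) ^+ k.
Proof.
have /andP[p0 _] := p01.
apply: le_trans (expect_walk_endsS _ _) _; first by rewrite inE.
apply: (@le_trans _ _ (\sum_(u | sedge x u && (u \notin set0)) p * (d.-1%:R * p) ^+ k)).
  apply: ler_sum => u /andP[xu _]; rewrite ler_wpM2l // expect_walk_ends //.
    by rewrite !inE orbF; apply: contraTneq xu => ->; rewrite sedge_irrefl.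
  by exists x; rewrite ?setU11 // sedge_sym.
rewrite sumr_const -[leLHS]mulr_natl mulrA ler_wpM2r //.
  by rewrite exprn_ge0 // mulr_ge0.
rewrite ler_wpM2r // ler_nat -(reg x) /degree cardsE.
by apply: subset_leq_card; apply/subsetP => u /andP[].
Qed.

Lemma sum_geom_le (r : R) n : 0 <= r < 1 -> \sum_(i < n) r ^+ i <= (1 - r)^-1.
Proof.
move=> /andP[r0 r1]; rewrite -[leRHS]mul1r ler_pdivlMr ?subr_gt0 //.
have := subrX1 r n; have := exprn_ge0 n r0; lra.
Qed.

Lemma expect_cluster x : d.-1%:R * p < 1 ->
  expect p (edges G) (fun F => #|cluster F x|%:R) <=
  1 + d%:R * p / (1 - d.-1%:R * p).
Proof.
have /andP[p0 _] := p01; move=> r1.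
apply: (@le_trans _ _ (expect p (edges G)
   (fun F => \sum_(k < #|G|) #|walk_ends F k set0 x|%:R))).
  apply: le_expect => // F _; rewrite -natr_sum ler_nat.
  apply: leq_trans (subset_leq_card (cluster_walk_ends F x)) _.
  elim/big_rec2 : _ => [|u A m _ IH]; first by rewrite cards0.
  by rewrite (leq_trans (leq_card_setU _ _).1) // leq_add2l.
rewrite expect_sum; case: #|G| (svertex_gt0 G) => // n _.
rewrite big_ord_recl lerD //.
  rewrite (eq_expect _ _ (h := fun=> 1)) ?expect_cst // => F.
  by rewrite cards1.
apply: (@le_trans _ _ (\sum_(i < n) d%:R * p * (d.-1%:R * p) ^+ i)).
  by apply: ler_sum => i _; apply: expect_walk_ends0.
rewrite -mulr_sumr ler_wpM2l ?mulr_ge0 //.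
by apply: sum_geom_le; rewrite r1 mulr_ge0.
Qed.

(** Each vertex of the cluster of [x] contributes the order of that same cluster. *)
Lemma sum_cluster_ge F x : (#|cluster F x| ^ 2 <= \sum_y #|cluster F y|)%N.
Proof.
rewrite (bigID [in cluster F x]) /= -[X in (X <= _)%N]addn0 leq_add //.
rewrite -mulnn -sum_nat_const; apply: leq_sum => y yx.
by rewrite (cluster_eq yx).
Qed.

Lemma giant_prob_subcritical c : 0 < c -> d.-1%:R * p < 1 ->
  percolation_prob p G (has_component_ge c) <=
  (1 + d%:R * p / (1 - d.-1%:R * p)) / (c ^+ 2 * #|G|%:R).
Proof.
move=> c0 r1; have N0 : 0 < #|G|%:R :> R by rewrite ltr0n svertex_gt0.
rewrite percolation_probE ler_pdivlMr ?mulr_gt0 ?exprn_gt0 //.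
(* The extra factor [#|G|] produces [(c * #|G|) ^+ 2] for Markov's inequality, against a sum of
   [#|G|] expectations. *)
rewrite -(ler_pM2r N0).
have -> (x : R) : x * (c ^+ 2 * #|G|%:R) * #|G|%:R = (c * #|G|%:R) ^+ 2 * x by ring.
rewrite -expectZ.
apply: (@le_trans _ _ (expect p (edges G) (fun F => \sum_x #|cluster F x|%:R))).
  apply: le_expect => // F _; case: has_component_geP => [[x cx]|_].
    rewrite mulr1; apply: (@le_trans _ _ (#|cluster F x| ^ 2)%:R).
      rewrite natrX !expr2; have cN : 0 <= c * #|G|%:R by rewrite mulr_ge0 ?ltW.
      exact: ler_pM.
    by rewrite -natr_sum ler_nat sum_cluster_ge.
  by rewrite mulr0 sumr_ge0.
rewrite expect_sum mulr_natr -sumr_const; apply: ler_sum => x _.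
exact: expect_cluster.
Qed.

End Subcritical.

(** * Limits *)

(** By [exprB1_le], any [h] at least [1 / (s * t)] is large enough. *)
Lemma expr_small (R : realType) (s t : R) : 0 < s <= 1 -> 0 < t ->
  exists h0, forall h, (h0 <= h)%N -> (1 - s) ^+ h <= t.
Proof.
move=> /andP[s0 s1] t0.
have st0 : 0 < s * t by exact: mulr_gt0.
exists (Num.bound (s * t)^-1) => h h0h.
have hst : 1 <= h%:R * s * t.
  rewrite -mulrA -ler_pdivrMr // mul1r ltW //.
  apply: lt_le_trans (archi_boundP _) _; first by rewrite invr_ge0 ltW.
  by rewrite ler_nat.
have := @exprB1_le R s h; rewrite (ltW s0) s1 => /(_ isT).
have : 0 <= (1 - s) ^+ h by rewrite exprn_ge0 // subr_ge0.
have : 0 <= h%:R * s by rewrite mulr_ge0 // ltW.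
move: ((1 - s) ^+ h) (h%:R * s) hst => x y; nra.
Qed.

(** With [y = m * r] and [a = 1 - 1 / y], one has [1 + m * r * a = y], so [exprB1_le] bounds the
    power by [1 / y], which is [1 - a]. *)
Lemma near_critical (R : realType) (m : nat) (r : R) :
  1 < m%:R * r -> 0 <= r <= 1 ->
  exists a : R, 0 < a <= 1 /\ (1 - r * a) ^+ m <= 1 - a.
Proof.
move=> mr /andP[r0 r1]; set y := m%:R * r in mr *.
have y0 : 0 < y by apply: lt_trans mr.
have iy : y * y^-1 = 1 by rewrite mulfV // gt_eqF.
have iy0 : 0 < y^-1 by rewrite invr_gt0.
have iy1 : y^-1 < 1 by rewrite invf_lt1.
exists (1 - y^-1); split; first by apply/andP; split; lra.
have ra : 0 <= r * (1 - y^-1) <= 1 by apply/andP; split; nra.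
have := exprB1_le m ra.
have -> : 1 + m%:R * (r * (1 - y^-1)) = y.
  by rewrite mulrA -/y mulrBr iy mulr1 addrC subrK.
move=> xy; rewrite -(ler_pM2r y0); have -> // : (1 - (1 - y^-1)) * y = 1.
by rewrite opprB addrC subrK mulrC.
Qed.

(** The density [c] precedes [t], since one [c] must serve all error levels. *)
Lemma supercritical_bound (R : realType) (d : nat) (p b : R) :
  (2 <= d)%N -> p <= 1 -> 1 < d.-1%:R * p -> 0 < b ->
  exists c : R, 0 < c /\ forall t : R, 0 < t -> exists m k : nat,
    forall G : sgraph, regular d G ->
      (forall A : {set G}, (0 < #|A|)%N -> (2 * #|A| <= #|G|)%N ->
         b * #|A|%:R <= #|edges_between A (~: A)|%:R) ->
      girth_gt G k -> (m <= #|G|)%N ->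
      1 - percolation_prob p G (has_component_ge c) <= t.
Proof.
move=> d2 p1 dp b0.
have d0 : 0 < d.-1%:R :> R by rewrite ltr0n -ltnS prednK // ltnW.
have d1 : 1 <= d.-1%:R :> R by rewrite ler1n -(ltr0n R).
pose v := (d.-1%:R)^-1 : R.
have dv : d.-1%:R * v = 1 by rewrite mulfV // gt_eqF.
have v0 : 0 < v by rewrite invr_gt0.
have vp : v < p by rewrite -(ltr_pM2l d0) dv.
(* Midpoint of the critical value and [p]: still supercritical, with room left for sprinkling. *)
pose r := (v + p) / 2.
have vr : v < r by rewrite /r; lra.
have rp : r < p by rewrite /r; lra.
have r01 : 0 <= r <= 1 by apply/andP; split; lra.
have [|a [a01 ra]] := @near_critical R d.-1 r _ r01; first by rewrite -[ltLHS]dv ltr_pM2l.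
have /andP[a0 a1] := a01.
pose e := (p - r) / (1 - r).
have r1 : 0 < 1 - r by lra.
have e0 : 0 < e by rewrite divr_gt0 // subr_gt0.
have e1 : e <= 1 by rewrite ler_pdivrMr // mul1r lerD2r.
have pre : 1 - p = (1 - r) * (1 - e).
  by rewrite /e; field; rewrite gt_eqF.
have e01 : 0 <= e <= 1 by rewrite ltW.
pose c := a / 6; have c0 : 0 < c by rewrite divr_gt0.
have bc : 0 < b * c by apply: mulr_gt0.
pose l := Num.bound (d%:R / (b * c)).
have ldc : d%:R < l%:R * (b * c).
  by rewrite -ltr_pdivrMr // archi_boundP // divr_ge0 // ltW.
(* With [h] links per large cluster, the failure [1 / 4] beats the factor 2 for choosing its side of
   the split. *)
have [h /(_ h (leqnn h)) hq] : exists h0, forall h, (h0 <= h)%N ->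
    (1 - e ^+ l.*2) ^+ h <= 1 / 4.
  apply: expr_small; last lra.
  by rewrite exprn_gt0 // exprn_ile1 // ltW.
(* Chosen so that [h * (#|G| %/ k)] links, of at most [l.*2] edges each, fit in the expansion
   budget. *)
pose k := Num.bound ((4 * l * h)%:R / (b * c)).
have kdc : (4 * l * h)%:R < k%:R * (b * c).
  by rewrite -ltr_pdivrMr // archi_boundP // divr_ge0 // ltW.
have k0 : (0 < k)%N.
  rewrite -(ltr0n R); rewrite -(ltr_pM2r bc) mul0r; exact: le_lt_trans kdc.
exists c; split => // t t0.
have t2 : 0 < t / 2 by rewrite divr_gt0.
have [h0 hh0] : exists h0, forall h, (h0 <= h)%N -> (1 - 1 / 2) ^+ h <= t / 2.
  by apply: expr_small => //; apply/andP; split; lra.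
pose C : R := 4 * (d.+1 ^ k.*2)%:R / a ^+ 2.
have C0 : 0 <= C by rewrite divr_ge0 // ?exprn_ge0 ?mulr_ge0 // ltW.
pose m := maxn (Num.bound (C / (t / 2))) (h0 * k).
exists m, k.*2 => G reg iso gk mG.
have N0 : 0 < #|G|%:R :> R by rewrite ltr0n svertex_gt0.
pose K := (#|G| %/ k)%N.
have jN : 2 * (l.*2 * (h * K))%:R <= b * c * #|G|%:R.
  apply: (@le_trans _ _ (b * c * (K * k)%:R)); last first.
    by rewrite ler_pM2l // ler_nat leq_divM.
  have -> : 2 * (l.*2 * (h * K))%:R = K%:R * (4 * l * h)%:R :> R.
    by rewrite -!natrM -muln2; congr (_%:R); ring.
  have -> : b * c * (K * k)%:R = K%:R * (k%:R * (b * c)) by rewrite natrM; ring.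
  by rewrite ler_wpM2l // ltW.
have := giant_prob reg (ltnW d2) b0 iso pre r01 e01 a01 ra gk k0 ldc jN.
rewrite -/c -/K => H; apply: le_trans H _.
rewrite [leRHS](splitr t); apply: lerD.
  have -> : 4 * (d.+1 ^ k.*2)%:R / (a ^+ 2 * #|G|%:R) = C / #|G|%:R.
    by rewrite /C; field; rewrite !gt_eqF.
  rewrite ler_pdivrMr // mulrC -ler_pdivrMr // ltW //.
  apply: lt_le_trans (archi_boundP _) _; first by rewrite divr_ge0 // ltW.
  by rewrite ler_nat (leq_trans _ mG) // leq_maxl.
have /hh0 : (h0 <= K)%N by rewrite leq_divRL // (leq_trans _ mG) // leq_maxr.
(* Grouping the powers gives [(2 * (1 - e ^+ l.*2) ^+ h) ^+ K], at most [(1 / 2) ^+ K]. *)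
apply: le_trans; rewrite exprM -exprMn; apply: lerXn2r; rewrite ?nnegrE; last by move: hq; lra.
  by rewrite mulr_ge0 // exprn_ge0 // subr_ge0 exprn_ile1 // ltW.
lra.
Qed.

Lemma subcritical_bound (R : realType) (d : nat) (p c t : R) :
  0 <= p <= 1 -> d.-1%:R * p < 1 -> 0 < c -> 0 < t ->
  exists m : nat, forall G : sgraph, regular d G -> (m <= #|G|)%N ->
    percolation_prob p G (has_component_ge c) <= t.
Proof.
move=> p01 dp c0 t0; have /andP[p0 _] := p01.
pose C : R := (1 + d%:R * p / (1 - d.-1%:R * p)) / c ^+ 2.
have C0 : 0 <= C.
  rewrite divr_ge0 ?exprn_ge0 ?(ltW c0) // addr_ge0 // divr_ge0 ?mulr_ge0 //.
  by rewrite subr_ge0 ltW.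
exists (Num.bound (C / t)) => G reg mG.
have N0 : 0 < #|G|%:R :> R by rewrite ltr0n svertex_gt0.
apply: le_trans (giant_prob_subcritical reg p01 c0 dp) _.
rewrite invfM mulrA -/C ler_pdivrMr // mulrC -ler_pdivrMr // ltW //.
apply: lt_le_trans (archi_boundP _) _; first by rewrite divr_ge0 // ltW.
by rewrite ler_nat.
Qed.

Lemma percolation_prob_01 (R : realType) (p : R) (G : sgraph) (Q : pred sgraph) :
  0 <= p <= 1 -> 0 <= percolation_prob p G Q <= 1.
Proof.
move=> p01; rewrite percolation_probE; apply: expect_01 => // F.
by case: (Q _); rewrite ?lexx ?ler01.
Qed.

(* Convergence along the expander sequence *)
From mathcomp Require Import all_classical all_reals all_analysis.

Import numFieldNormedType.Exports.

Local Open Scope classical_set_scope.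

Lemma girth_gt_near (R : realType) (G : nat -> sgraph) m :
  girth R (G n) @[n --> \oo] --> +oo%E -> \forall n \near \oo, girth_gt (G n) m.
Proof.
move=> /cvgeyPge/(_ m.+1%:R); apply: filterS => n mG c cc.
rewrite -(ler_nat R) -lee_fin; apply: le_trans mG _.
by apply: ereal_inf_lbound; exists c.
Qed.

Lemma expander_edges_between (R : realType) (G : sgraph) (b : R) (A : {set G}) :
  (b%:E <= edge_isoperimetric_number R G)%E ->
  (0 < #|A|)%N -> (2 * #|A| <= #|G|)%N ->
  b * #|A|%:R <= #|edges_between A (finset.setC A)|%:R.
Proof.
move=> bG A0 AG; rewrite -ler_pdivlMr ?ltr0n // -lee_fin.
by apply: le_trans bG _; apply: ereal_inf_lbound; exists A.
Qed.

Theorem theorem3p2 (R : realType) (d : nat) (G : nat -> sgraph) (p : R)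
    (hd : (2 <= d)%N)
    (hreg : forall n, regular d (G n))
    (hexp : expander_sequence R G)
    (hgirth : girth R (G n) @[n --> \oo] --> +oo%E)
    (hp : 0 <= p <= 1) :
  (p > 1 / (d%:R - 1) ->
     exists c : R, 0 < c /\
       percolation_prob p (G n) (has_component_ge c) @[n --> \oo] --> (1 : R)) /\
  (p < 1 / (d%:R - 1) ->
     forall c : R, 0 < c ->
       percolation_prob p (G n) (has_component_ge c) @[n --> \oo] --> (0 : R)).
Proof.
have d0 : 0 < d.-1%:R :> R by rewrite ltr0n -ltnS prednK // ltnW.
have -> : d%:R - 1 = d.-1%:R :> R by rewrite -[in LHS](prednK (ltnW hd)) -natr1 addrK.
(* The orders tend to infinity because the girths do. *)
have big m : \forall n \near \oo, (m <= #|G n|)%N.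
  apply: filterS (girth_gt_near m hgirth) => n gm.
  exact: ltnW (card_gt_girth hd (hreg n) gm).
split=> [|pd c c0].
  rewrite ltr_pdivrMr // mulrC => pd.
  have [_ [b [b0 bG]]] := hexp.
  have [|c [c0 hc]] := supercritical_bound hd _ pd b0; first by case/andP: hp.
  exists c; split=> //; apply/cvgrPdist_le => t t0.
  have [m [k hmk]] := hc t t0.
  apply: filterS2 (big m) (girth_gt_near k hgirth) => n mG gk.
  rewrite ger0_norm; last first.
    by rewrite subr_ge0; case/andP: (percolation_prob_01 (G n) (has_component_ge c) hp).
  apply: hmk => // A; exact: expander_edges_between (bG n).
rewrite ltr_pdivlMr // mulrC in pd.
apply/cvgrPdist_le => t t0.
have [m hm] := subcritical_bound hp pd c0 t0.
apply: filterS (big m) => n mG; rewrite sub0r normrN ger0_norm ?hm //.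
by case/andP: (percolation_prob_01 (G n) (has_component_ge c) hp).
Qed.
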